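(* Let $G$ be a graph with a perfect matching. Then the following statements are equivalent: (1) $G$ is a Sterboul--Deming graph with a unique perfect matching. (2) $G$ has no leaves, and for some perfect matching $M$ of $G$, $G$ has no $M$-alternating cycle. (3) $G$ has no leaves, and for every perfect matching $M$ of $G$, $G$ has no $M$-alternating cycle.
   Context: All graphs are finite, undirected and simple. A leaf is a vertex of degree $1$. Let $M$ be a matching of a graph $G$. A path (or walk) is $M$-alternating if, of any two consecutive edges, exactly one belongs to $M$; an $M$-alternating cycle is a cycle (necessarily even) whose edges alternate between $M$ and its complement. An $mm$-$M$-path is an $M$-alternating path whose first and last edges are in $M$. An $M$-blossom is an odd cycle of length $2k+1$ with exactly $k$ edges in $M$; its base is the unique vertex of the cycle not covered by those $k$ edges. An $M$-Tflower consists of an $M$-blossom together with an $M$-stem, i.e. an $M$-alternating path of even length (possibly zero) connecting the base of the blossom to a vertex not saturated by $M$ in $G$, where the base is the only common vertex of the blossom and the stem. An $M$-Tposy consists of two $M$-blossoms joined by an $mm$-$M$-path whose endpoints are the bases of the two blossoms, such that no internal vertex of the path lies in the blossoms and the intersection of the two blossoms is either empty or an $mm$-$M$-path. Define $SD(G)$ as the set of vertices $v$ of $G$ for which there is a maximum matching $M$ of $G$ such that $v$ lies in an $M$-Tflower or an $M$-Tposy, and $KE(G)=V(G)\setminus SD(G)$. A graph $G$ is a Sterboul--Deming graph if $KE(G)=\emptyset$. *)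

(* Defs.v *)
From mathcomp Require Import all_boot.
From mathcomp Require Import boolp.

Set Implicit Arguments.
Unset Strict Implicit.
Unset Printing Implicit Defensive.

(* A finite simple graph is a relation e on a finType T that is symmetric and
   irreflexive (both are hypotheses wherever they matter); an edge is the
   unordered pair [set x; y], and a matching is a set of such pairs. *)

Section Graph.

Variables (T : finType) (e : rel T).

Implicit Types (M : {set {set T}}) (E F : {set T}) (c s : seq T) (x v b : T).

Definition edges : {set {set T}} :=
  [set E | [exists x, exists y, e x y && (E == [set x; y])]].

Definition degree v : nat := #|[set u | e v u]|.

Definition leaf v : bool := degree v == 1.

Definition matching M : bool := (M \subset edges) && trivIset M.

Definition saturated M v : bool := v \in cover M.

Definition perfect_matching M : bool :=
  matching M && [forall v, saturated M v].

Definition maximum_matching M : bool :=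
  matching M && [forall M' : {set {set T}}, matching M' ==> (#|M'| <= #|M|)].

(* A path is given by its first vertex x and the sequence s of the others, as
   in mathcomp.boot.path; its length is [size s]. *)
Definition simple_path x s : bool := path e x s && uniq (x :: s).

Definition path_edges x s : seq {set T} :=
  pairmap (fun u v => [set u; v]) x s.

(* A cycle is given by the sequence of its vertices in cyclic order; its length
   is [size c]. The size bound excludes loops and a single edge traversed back
   and forth. *)
Definition simple_cycle c : bool := [&& 2 < size c, cycle e c & uniq c].

Definition cycle_edges c : seq {set T} :=
  if c is x :: s then path_edges x (rcons s x) else [::].

Definition alternate M : rel {set T} := fun E F => (E \in M) (+) (F \in M).

Definition alternating_path M x s : bool :=
  simple_path x s && sorted (alternate M) (path_edges x s).

(* [cycle (alternate M)] also compares the last edge with the first one. *)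
Definition alternating_cycle M c : bool :=
  simple_cycle c && cycle (alternate M) (cycle_edges c).

Definition mm_path M x s : bool :=
  [&& alternating_path M x s, s != [::],
      head set0 (path_edges x s) \in M & last set0 (path_edges x s) \in M].

Definition blossom M c : bool :=
  [&& simple_cycle c, odd (size c) &
      count (mem M) (cycle_edges c) == (size c)./2].

Definition blossom_base M c b : bool :=
  [set v in c | ~~ has (fun E => (E \in M) && (v \in E)) (cycle_edges c)]
    == [set b].

Definition stem M c b s : bool :=
  [&& alternating_path M b s, ~~ odd (size s), ~~ saturated M (last b s) &
      [forall v, (v \in c) && (v \in b :: s) == (v == b)]].

Definition Tflower M c b s : bool :=
  [&& blossom M c, blossom_base M c b & stem M c b s].

(* The intersection of the two cycles, taken as subgraphs (vertices and edges),
   is empty or an mm-M-path. *)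
Definition empty_or_mm_intersection M c1 c2 : Prop :=
  (forall v, ~~ ((v \in c1) && (v \in c2))) \/
  exists x s, [/\ mm_path M x s,
    forall v, (v \in x :: s) = (v \in c1) && (v \in c2) &
    forall E, (E \in path_edges x s) =
              (E \in cycle_edges c1) && (E \in cycle_edges c2)].

Definition Tposy M c1 c2 x s : Prop :=
  [/\ blossom M c1 && blossom_base M c1 x,
      blossom M c2 && blossom_base M c2 (last x s),
      mm_path M x s,
      forall v, v \in x :: s -> v != x -> v != last x s ->
        (v \notin c1) && (v \notin c2)
    & empty_or_mm_intersection M c1 c2].

Definition in_Tflower M v : Prop :=
  exists c b s, Tflower M c b s /\ (v \in c) || (v \in b :: s).

Definition in_Tposy M v : Prop :=
  exists c1 c2 x s,
    Tposy M c1 c2 x s /\ [|| v \in c1, v \in c2 | v \in x :: s].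

Definition SD : {set T} :=
  [set v | `[< exists2 M, maximum_matching M & in_Tflower M v \/ in_Tposy M v >]].

Definition KE : {set T} := ~: SD.

Definition sterboul_deming : Prop := KE = set0.

End Graph.

(* Main.v *)
(** Fix a perfect matching [M] without alternating cycles in a graph without
    leaves, and a vertex [v]. In a maximal mm-[M]-path [p_0, ..., p_{2k+1}]
    through [v], each end has a second neighbour, which by maximality lies on
    the path. Having no alternating cycle, the neighbour [p_j] of [p_{2k+1}] has
    odd index and the neighbour [p_i] of [p_0] has even index, so each end closes
    a blossom. If [j < i], then [p_0, ..., p_j, p_{2k+1}, ..., p_i] is an
    alternating cycle; hence [i < j], the blossoms are disjoint, and the path
    between their bases completes a Tposy that contains [v].

    An alternating cycle yields a second perfect matching by switching, and a
    second perfect matching yields an alternating cycle as an orbit of the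
    composition of the two mate involutions. *)

Require Import Defs.
From mathcomp Require Import all_boot.
From mathcomp Require Import boolp.

Set Implicit Arguments.
Unset Strict Implicit.
Unset Printing Implicit Defensive.

(** * Sequences, edge lists and colour words *)

(** Repetition-free sequences have length at most [#|T|], so a greatest length is attained. *)
Lemma exists_longest (T : finType) (P : pred (seq T)) (s0 : seq T) :
    (forall s, P s -> uniq s) -> P s0 ->
  exists2 s, P s & forall s', P s' -> size s' <= size s.
Proof.
move=> Puniq Ps0.
pose Q n := [exists t : n.-tuple T, P t].
have QP s : P s -> Q (size s).
  by move=> Ps; apply/existsP; exists (in_tuple s).
have exQ : exists n, Q n by exists (size s0); apply: QP.
have Qle n : Q n -> n <= #|T|.
  case/existsP=> t /Puniq t_uniq.
  by rewrite -(size_tuple t) -(card_uniqP t_uniq) max_card.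
case: (ex_maxnP exQ Qle) => n /existsP[t Pt] nmax.
by exists t => // s' /QP /nmax; rewrite size_tuple.
Qed.

Lemma cycle_edges_next (T : finType) (c : seq T) :
  uniq c -> cycle_edges c = [seq [set x; next c x] | x <- c].
Proof.
case: c => // x s c_uniq.
apply: (@eq_from_nth _ set0).
  by rewrite size_map /cycle_edges /path_edges size_pairmap size_rcons.
move=> i; rewrite /cycle_edges /path_edges size_pairmap size_rcons => lt_i.
rewrite (nth_pairmap x) ?size_rcons // (nth_map x) //.
rewrite next_nth mem_nth // index_uniq // -rcons_cons nth_rcons lt_i.
rewrite nth_rcons; congr [set _; _].
(* At the last index the closing vertex [x] agrees with the default value of [nth] through which
   [next] wraps around. *)
move: lt_i; rewrite ltnS leq_eqVlt => /predU1P[->|->] //.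
by rewrite ltnn eqxx nth_default.
Qed.

(** Compares two cuts of one sequence: either [y] stands at or after [x], with [E] the stretch after
    [x] up to [y], or [y] stands strictly before [x]. *)
Lemma cat_cons_eq (T : Type) (A1 A2 B1 B2 : seq T) x y :
    A1 ++ x :: B1 = A2 ++ y :: B2 ->
  (exists2 E, B1 = E ++ B2 & last x E = y) \/ (exists F, A1 = A2 ++ y :: F).
Proof.
elim: A1 A2 => [|a A1 IHA] [|b A2] /= [].
- by move=> -> ->; left; exists [::].
- by move=> -> ->; left; exists (rcons A2 y); rewrite ?last_rcons ?cat_rcons.
- by move=> -> _; right; exists A1.
- by move=> -> /IHA[?|[F ->]]; [left|right; exists F].
Qed.

Lemma path_edges_rcons (T : finType) (x y : T) s :
  path_edges x (rcons s y) = rcons (path_edges x s) [set last x s; y].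
Proof. by elim: s x => //= z s IHs x; rewrite IHs. Qed.

Lemma mem_path_edges (T : finType) (x v : T) s (E : {set T}) :
  E \in path_edges x s -> v \in E -> v \in x :: s.
Proof.
elim: s x => //= y s IHs x; rewrite inE => /predU1P[->|/IHs vE /vE vs].
  by rewrite !inE => /orP[]->; rewrite ?orbT.
by rewrite inE vs orbT.
Qed.

(* Membership in M of the successive edges of an alternating path that starts
   outside M and ends in M. *)
Definition walk_colors n := flatten (nseq n [:: false; true]).

Lemma path_walk_colors n : path addb true (walk_colors n).
Proof. by elim: n. Qed.

Lemma last_walk_colors n : last true (walk_colors n).
Proof. by elim: n. Qed.

Lemma count_walk_colors n : count id (walk_colors n) = n.
Proof. by elim: n => //= n ->. Qed.

Section Graph.

Variables (T : finType) (e : rel T).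
Hypotheses (e_sym : symmetric e) (e_irr : irreflexive e).

Implicit Types (M : {set {set T}}) (E : {set T}) (x y v a b : T) (s c : seq T).

(** * Edges, and maximum versus perfect matchings *)

Lemma edge_neq x y : e x y -> x != y.
Proof. by apply: contraTneq => ->; rewrite e_irr. Qed.

Lemma mem_edges x y : ([set x; y] \in edges e) = e x y.
Proof.
rewrite inE; apply/existsP/idP => [[a /existsP[b /andP[eab /eqP eqE]]]|exy]; last first.
  by exists x; apply/existsP; exists y; rewrite exy eqxx.
have := set21 a b; have := set22 a b; have := edge_neq eab.
rewrite -eqE !inE => neq /orP[]/eqP eqb /orP[]/eqP eqa; subst a b => //.
- by rewrite eqxx in neq.
- by rewrite e_sym.
- by rewrite eqxx in neq.
Qed.

Lemma card_cover_matching M : matching e M -> #|cover M| = #|M| * 2.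
Proof.
case/andP=> /subsetP sM /eqP <-; rewrite -sum_nat_const; apply: eq_bigr => E.
move/sM; rewrite inE => /existsP[a /existsP[b /andP[eab /eqP ->]]].
by rewrite cards2 edge_neq.
Qed.

Lemma cover_perfect M : perfect_matching e M -> cover M = setT.
Proof.
case/andP=> _ /forallP sat; apply/setP => x; rewrite inE.
exact: sat.
Qed.

Lemma perfect_maximum M : perfect_matching e M -> maximum_matching e M.
Proof.
move=> pM; have [mM _] := andP pM; rewrite /maximum_matching mM.
apply/forallP=> M'; apply/implyP => mM'.
rewrite -(leq_pmul2r (isT : 0 < 2)) -!card_cover_matching //.
by rewrite (cover_perfect pM) subset_leq_card // subsetT.
Qed.

(** Disjoint two-element edges make the size of a matching half the size of its cover, so a matching
    at least as large as a perfect one covers everything. *)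
Lemma maximum_perfect M M' :
  perfect_matching e M' -> maximum_matching e M -> perfect_matching e M.
Proof.
move=> pM' /andP[mM /forallP /(_ M')].
have [mM' _] := andP pM'; rewrite mM' /= => le_M.
rewrite /perfect_matching mM; apply/forallP => x.
suff /eqP covM : cover M == setT by rewrite /saturated covM inE.
rewrite eqEcard subsetT -(cover_perfect pM') !card_cover_matching //.
by rewrite leq_pmul2r.
Qed.

(** * Leaves, and their absence in Sterboul--Deming graphs *)

Lemma not_leaf v a b : e v a -> e v b -> a != b -> ~~ leaf e v.
Proof.
move=> eva evb ab; apply/negP => /cards1P[z eqz].
have : a \in [set u | e v u] by rewrite inE.
have : b \in [set u | e v u] by rewrite inE.
by rewrite eqz !inE => /eqP bz /eqP az; rewrite az bz eqxx in ab.
Qed.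

Lemma not_leaf_neighbor v a : ~~ leaf e v -> e v a -> exists2 b, e v b & b != a.
Proof.
rewrite /leaf /degree => nl eva.
have aN : a \in [set u | e v u] by rewrite inE.
move: nl; rewrite (cardsD1 a) aN add1n eqSS -lt0n => /card_gt0P[b].
by rewrite !inE => /andP[ba evb]; exists b.
Qed.

Lemma cycle_not_leaf c v : simple_cycle e c -> v \in c -> ~~ leaf e v.
Proof.
case/and3P=> szc ec uc /rot_to[i c' eqc].
move: szc ec uc; rewrite -(size_rot i) -(rot_cycle i) -(rot_uniq i) eqc.
case/lastP: c' {eqc} => // -[//|a c'] z _.
rewrite /= rcons_path last_rcons => /and3P[eva _ ezv] /and3P[_ az _].
apply: (not_leaf eva (_ : e v z)); first by rewrite e_sym.
by apply: contraNneq az => ->; rewrite mem_rcons mem_head.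
Qed.

Lemma internal_not_leaf x s v : simple_path e x s ->
  v \in x :: s -> v != x -> v != last x s -> ~~ leaf e v.
Proof.
move=> /andP[+ +] + vx; rewrite inE (negPf vx) /=.
move=> + + /splitPr v_s; case: v_s => s1 [|y s2].
  by rewrite last_cat /= eqxx.
rewrite cat_path /= => /and4P[_ ev evy _] /andP[xs us] _.
apply: (not_leaf (a := last x s1) _ evy); first by rewrite e_sym.
have : uniq (x :: s1 ++ v :: y :: s2) by rewrite /= xs us.
rewrite -cat_cons cat_uniq => /and3P[_ /hasPn/(_ y) + _].
rewrite !inE eqxx orbT => /(_ isT); apply: contraNneq => <-.
by rewrite -[_ || _]/(last x s1 \in x :: s1) mem_last.
Qed.

Lemma blossom_base_mem M c b : blossom_base M c b -> b \in c.
Proof. by move/eqP/setP/(_ b); rewrite !inE eqxx => /andP[]. Qed.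

(** Maximum matchings are perfect here, so the unsaturated end of a stem cannot exist and only
    Tposies remain. A vertex of a Tposy lies on a cycle or inside the connecting path, and has two
    neighbours in either case. *)
Lemma sterboul_deming_no_leaf :
    (exists M, perfect_matching e M) -> sterboul_deming e ->
  forall v, ~~ leaf e v.
Proof.
move=> [M0 pM0] sd v.
have : v \in SD e by rewrite -[_ \in _]negbK -in_setC -/(KE e) sd inE.
rewrite inE => /asboolP[M maxM].
have /andP[_ /forallP sat] := maximum_perfect pM0 maxM.
case=> [[c [b [s [/and3P[_ _ /and4P[_ _ /negP unsat _]] _]]]]|]; first by case: unsat; apply: sat.
move=> [c1 [c2 [x [s [[/andP[/andP[cyc1 _] bb1] /andP[/andP[cyc2 _] bb2] mm _ _] v_in]]]]].
have [v1|v1] := boolP (v \in c1); first exact: cycle_not_leaf v1.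
have [v2|v2] := boolP (v \in c2); first exact: cycle_not_leaf v2.
move: v_in; rewrite (negPf v1) (negPf v2) /= => vs.
case/and4P: mm => /andP[sp _] _ _ _; apply: internal_not_leaf sp vs _ _.
  by apply: contraNneq v1 => ->; apply: blossom_base_mem bb1.
by apply: contraNneq v2 => ->; apply: blossom_base_mem bb2.
Qed.

(** * Perfect matchings as fixed-point-free involutions, and their alternating walks *)

Definition mate_matching (m : T -> T) : {set {set T}} := [set [set x; m x] | x : T].

Section Mate.

Variable m : T -> T.
Hypotheses (mK : involutive m) (e_mate : forall x, e x (m x)).

Local Notation M := (mate_matching m).

Lemma mate_neq x : m x != x.
Proof. by rewrite eq_sym edge_neq. Qed.

Lemma mate_matching_eq E x : E \in M -> x \in E -> E = [set x; m x].
Proof. by move=> /imsetP[y _ ->]; rewrite !inE => /orP[]/eqP-> //; rewrite mK setUC. Qed.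

Lemma mem_mate_matching x y : ([set x; y] \in M) = (y == m x).
Proof.
apply/idP/eqP => [EM|->]; last exact: imset_f.
have eqE := mate_matching_eq EM (set21 x y).
by have := set22 x (m x); rewrite -eqE !inE (negPf (mate_neq x)) => /eqP.
Qed.

Lemma mate_perfect : perfect_matching e M.
Proof.
apply/andP; split; last first.
  apply/forallP => x; apply/bigcupP; exists [set x; m x]; last exact: set21.
  exact: imset_f.
apply/andP; split; first by apply/subsetP => _ /imsetP[x _ ->]; rewrite mem_edges.
apply/trivIsetP => E F EM FM; apply: contraNT => /pred0Pn[x /andP[xE xF]].
by rewrite (mate_matching_eq EM xE) (mate_matching_eq FM xF).
Qed.

(* The walk [x_0, m x_0, x_1, m x_1, ...] is encoded by [x_0, x_1, ...]: a step
   from x to y is the non-matching edge from [m x] to [y]. *)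
Definition mate_step x y := e (m x) y && (y != x).

Fixpoint mate_walk s := if s is x :: s' then x :: m x :: mate_walk s' else [::].

Lemma mate_walk_cat s1 s2 : mate_walk (s1 ++ s2) = mate_walk s1 ++ mate_walk s2.
Proof. by elim: s1 => //= x s1 ->. Qed.

Lemma size_mate_walk s : size (mate_walk s) = (size s).*2.
Proof. by elim: s => //= x s ->. Qed.

Lemma last_mate_walk x s : last (m x) (mate_walk s) = m (last x s).
Proof. by elim: s x => /=. Qed.

Lemma mem_mate_walk x s : (x \in mate_walk s) = (x \in s) || (m x \in s).
Proof.
elim: s => //= y s IHs; rewrite !inE IHs -(can2_eq mK mK) orbACA.
by rewrite -!orbA.
Qed.

Lemma mate_in_walk x s : (m x \in mate_walk s) = (x \in mate_walk s).
Proof. by rewrite !mem_mate_walk mK orbC. Qed.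

(** Read backwards, a walk enters each pair through the mate. Hence [rev (map m s)] encodes the
    reversed walk, and results on the end of a walk also serve for its start. *)
Lemma mate_walk_rev s : mate_walk (rev (map m s)) = rev (mate_walk s).
Proof.
elim: s => //= x s IHs.
by rewrite !rev_cons -!cats1 mate_walk_cat IHs /= mK -catA.
Qed.

Lemma mate_step_rev x y : mate_step (m y) (m x) = mate_step x y.
Proof.
by rewrite /mate_step mK e_sym (inj_eq (can_inj mK)) eq_sym.
Qed.

Lemma sorted_mate_step_rev s :
  sorted mate_step (rev (map m s)) = sorted mate_step s.
Proof.
rewrite rev_sorted sorted_map; apply: eq_sorted => x y.
exact: mate_step_rev.
Qed.

Lemma rev_mate_rev s : rev (map m (rev (map m s))) = s.
Proof. by rewrite map_rev revK -map_comp map_id_in // => x _; apply: mK. Qed.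

Lemma mate_walk_colors x s : path mate_step x s ->
  [seq E \in M | E <- path_edges (m x) (mate_walk s)] = walk_colors (size s).
Proof.
elim: s x => //= y s IHs x /andP[/andP[_ yx] p].
by rewrite !mem_mate_matching mK (negPf yx) eqxx IHs.
Qed.

Lemma path_mate_walk x s : path mate_step x s -> path e (m x) (mate_walk s).
Proof.
by elim: s x => //= y s IHs x /andP[/andP[-> _] /IHs ->]; rewrite e_mate.
Qed.

Lemma mate_edge_in_walk x s v :
  v \in mate_walk s -> [set v; m v] \in path_edges x (mate_walk s).
Proof.
elim: s x => //= y s IHs x; rewrite !inE => /or3P[/eqP->|/eqP->|/IHs->].
- by rewrite eqxx orbT.
- by rewrite mK [[set m y; y]]setUC eqxx orbT.
- by rewrite !orbT.
Qed.

Lemma mate_walk_alternating_cycle s :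
    s != [::] -> cycle mate_step s -> uniq (mate_walk s) ->
  alternating_cycle e M (mate_walk s).
Proof.
case: s => // x s _; rewrite [cycle _ _]rcons_path => /andP[p /andP[exl xl]] us.
rewrite /alternating_cycle /simple_cycle us andbT.
apply/andP; split.
  apply/andP; split.
    (* With [s] empty the closing step would go from [x] to itself; otherwise the walk has at least
       four vertices. *)
    by case: s xl {p exl us} => //=; rewrite eqxx.
  by rewrite /= e_mate rcons_path path_mate_walk // last_mate_walk.
rewrite -[cycle (alternate M) _](cycle_map (f := fun E => E \in M) (e' := addb)) /=.
rewrite path_edges_rcons map_rcons mate_walk_colors // !mem_mate_matching eqxx.
rewrite last_mate_walk mK (negPf xl).
by rewrite !rcons_path path_walk_colors !last_rcons last_walk_colors.
Qed.

Lemma mate_walk_mm_path x s :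
    path mate_step x s -> uniq (mate_walk (x :: s)) ->
  mm_path e M x (m x :: mate_walk s).
Proof.
move=> p us; have xM : [set x; m x] \in M by rewrite mem_mate_matching.
apply/and4P; split=> //.
  apply/andP; split; first by rewrite /simple_path us /= e_mate path_mate_walk.
  rewrite -[sorted _ _](sorted_map (f := fun E => E \in M) (e' := addb)) /= mate_walk_colors //.
  by rewrite xM path_walk_colors.
rewrite /= -(last_map (fun E => E \in M)) mate_walk_colors // xM.
exact: last_walk_colors.
Qed.

(** Dropping [x] leaves an odd cycle on which every vertex but [m x] keeps its mate; the closing
    edge is outside the matching. *)
Lemma mate_walk_blossom x s :
    path mate_step x s -> e (m x) (m (last x s)) -> uniq (mate_walk (x :: s)) ->
  blossom e M (m x :: mate_walk s) && blossom_base M (m x :: mate_walk s) (m x).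
Proof.
move=> p exl us; have /= /andP[xs us'] := us.
have colors : [seq E \in M | E <- cycle_edges (m x :: mate_walk s)] =
              rcons (walk_colors (size s)) false.
  rewrite /= path_edges_rcons map_rcons mate_walk_colors // last_mate_walk.
  rewrite mem_mate_matching mK; congr rcons; apply/eqP => mxl.
  have := mem_last x s; rewrite -mxl inE (negPf (mate_neq x)) /= => mxs.
  by move: xs; rewrite inE mem_mate_walk mxs !orbT.
apply/andP; split.
  rewrite /blossom /simple_cycle /= -/(mate_walk _) us' size_mate_walk /=.
  rewrite odd_double uphalf_double !andbT -andbA; apply/and3P; split.
  - by case: (s) exl => [|y s'] /=; rewrite (e_irr, doubleS).
  - by rewrite rcons_path path_mate_walk // last_mate_walk e_sym.
  - rewrite -(count_map (fun E => E \in M) id) colors -cats1 count_cat /=.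
    by rewrite count_walk_colors !addn0.
rewrite /blossom_base; apply/eqP; apply/setP => v; rewrite !inE.
have [->|vx] /= := eqVneq v (m x).
  apply/hasPn => E Ec; apply/negP => /andP[EM mxE].
  have xE : x \in E by rewrite (mate_matching_eq EM mxE) mK set22.
  have := mem_path_edges Ec xE; rewrite inE mem_rcons inE orbA orbb.
  by rewrite -in_cons (negPf xs).
apply/andP => -[vs /hasPn/(_ [set v; m v])].
rewrite mem_mate_matching eqxx set21 => /(_ _)/negP; apply=> //.
by rewrite path_edges_rcons mem_rcons inE mate_edge_in_walk ?orbT.
Qed.

Lemma uniq_mate_walk s :
  uniq s -> {in s, forall x, m x \notin s} -> uniq (mate_walk s).
Proof.
elim: s => //= y s IHs /andP[ys us] disj.
have {}IHs : uniq (mate_walk s).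
  apply: IHs => // x xs; have := disj x; rewrite !inE xs orbT => /(_ isT).
  by case/norP.
have mys : m y \notin s.
  by have := disj y; rewrite !inE eqxx => /(_ isT) /norP[].
by rewrite IHs inE mate_in_walk mem_mate_walk eq_sym !negb_or mate_neq ys mys.
Qed.

Lemma uniq_of_mate_walk s : uniq (mate_walk s) -> uniq s.
Proof.
apply: subseq_uniq; elim: s => //= x s IHs; rewrite eqxx.
exact: subseq_trans IHs (subseq_cons _ _).
Qed.

Lemma uniq_mate_walk_rcons s x :
  uniq (mate_walk (rcons s x)) = uniq (mate_walk s) && (x \notin mate_walk s).
Proof.
rewrite -cats1 mate_walk_cat cat_uniq /= mate_in_walk inE eq_sym mate_neq.
by rewrite orbF orbb !andbT.
Qed.

(** * Consequences of the absence of alternating cycles *)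

Hypothesis no_cycle : forall c, ~~ alternating_cycle e M c.

Lemma no_mate_step_cycle s :
  s != [::] -> uniq (mate_walk s) -> ~~ cycle mate_step s.
Proof.
move=> sn us; apply: contra (no_cycle (mate_walk s)) => cs.
exact: mate_walk_alternating_cycle.
Qed.

Lemma mate_unique m' : involutive m' -> (forall x, e x (m' x)) -> m' =1 m.
Proof.
move=> m'K em' v; apply/eqP; apply: contraT => neq_v.
(* If [m x] were in the orbit of x under f, then, since f conjugated by m is its
   inverse, m or m' would fix the middle point between x and [m x]. *)
pose f := m' \o m.
have injf : injective f by apply: inj_comp; apply: can_inj.
have iter_f n x : m x != iter n f x.
  elim/ltn_ind: n x => -[_|[_|n IHn]] x; first exact: mate_neq.
    by rewrite /= /f edge_neq //= em'.
  apply: contra (IHn n _ (f x)) => // /eqP eqm.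
  rewrite -(inj_eq (can_inj mK)) mK -iterSr.
  by rewrite -(inj_eq (can_inj m'K)) -[m' (m _)]/(f _) -iterS -eqm /f /= m'K.
(* A fixed point in the orbit would be the whole orbit, against [m' v != m v]. This supplies the
   inequality required by [mate_step]. *)
have in_orbit x : x \in orbit f v -> x != f x.
  rewrite -fconnect_orbit fconnect_sym // => /iter_findex eqv.
  apply: contra neq_v => /eqP fx.
  have : v = x by rewrite -eqv; elim: (findex _ _ _) => //= n ->.
  by move=> ->; rewrite -(inj_eq (can_inj m'K)) m'K {1}fx.
have : ~~ cycle mate_step (orbit f v).
  apply: no_mate_step_cycle; first by rewrite -size_eq0 size_orbit -lt0n order_gt0.
  apply: uniq_mate_walk; first exact: orbit_uniq.
  move=> x; rewrite -!fconnect_orbit => vx; apply/negP => vmx.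
  have := iter_f (findex f x (m x)) x; rewrite iter_findex ?eqxx //.
  by rewrite -(same_connect (fconnect_sym injf) vx).
(* The step from [x] to [f x] follows the edge of the second matching at [m x]. *)
case/negP; apply: (sub_in_cycle (P := mem (orbit f v)) _ _ (cycle_orbit injf v)); last exact/allP.
move=> x y xo _ /= /eqP <-; rewrite /mate_step em' eq_sym /=.
exact: in_orbit.
Qed.

Lemma mate_walk_end x s :
    path mate_step x s -> uniq (mate_walk (x :: s)) -> ~~ leaf e (m (last x s)) ->
    (forall y, mate_step (last x s) y -> y \in mate_walk (x :: s)) ->
  exists A w B, x :: s = A ++ w :: B /\ e (m w) (m (last w B)).
Proof.
move=> p us nl max.
have [|b ezb bz] := not_leaf_neighbor nl (_ : e _ (last x s)).
  by rewrite e_sym e_mate.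
have step_b : mate_step (last x s) b by rewrite /mate_step ezb.
have := max b step_b; rewrite mem_mate_walk => /orP[]/splitPr eqs.
  (* If [b] itself is a letter of the code, the tail starting at [b] closes into an alternating
     cycle. *)
  have eql : last x s = last x (x :: s) by [].
  move: p us step_b {max nl ezb bz}; rewrite -[path _ _ _]/(sorted _ (x :: s)) eql.
  case: eqs => A B; rewrite last_cat /= mate_walk_cat cat_uniq.
  move=> /cat_sorted2[_ sB] /and3P[_ _ uB] zb.
  have /negP[] := no_mate_step_cycle (isT : b :: B != [::]) uB.
  by rewrite [cycle _ _]rcons_path zb andbT.
(* Otherwise the letter is [m b], and the tail after it closes into a blossom with base [b]. *)
have eql : last x s = last x (x :: s) by [].
move: ezb {p us max nl bz step_b}; rewrite eql; case: eqs => A B.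
rewrite last_cat /= => ezb; exists A, (m b), B; split=> //.
by rewrite mK e_sym.
Qed.

(* The two blossoms at the ends of a maximal walk are disjoint: if they
   overlapped, the two closing edges and the outer parts of the walk would form
   an alternating cycle. *)
Lemma mate_walk_Tposy s A w B C u D :
    sorted mate_step s -> uniq (mate_walk s) ->
    s = A ++ w :: B -> e (m w) (m (last w B)) ->
    rev (map m s) = C ++ u :: D -> e (m u) (m (last u D)) ->
  exists c1 c2 x p, Tposy e M c1 c2 x p /\
    forall v, v \in mate_walk s -> [|| v \in c1, v \in c2 | v \in x :: p].
Proof.
move=> ss us eqs ewB eqr euD.
have sr : sorted mate_step (rev (map m s)) by rewrite sorted_mate_step_rev.
have ur : uniq (mate_walk (rev (map m s))) by rewrite mate_walk_rev rev_uniq.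
have eqs' : s = rev (map m D) ++ m u :: rev (map m C).
  by rewrite -[s]rev_mate_rev eqr map_cat rev_cat /= rev_cons cat_rcons.
(* In the first case [w] is at or after [m u], and [m u :: E] encodes the path between the two bases
   [m u] and [m w]. *)
have [[E eqE lastE]|[F eqF]] := cat_cons_eq (etrans (esym eqs') eqs).
  have eq_s : s = rev (map m D) ++ (m u :: E) ++ B by rewrite eqs' eqE.
  have sE : path mate_step (m u) E.
    move: ss; rewrite eq_s => /cat_sorted2[_].
    by rewrite /= cat_path => /andP[].
  have sB : path mate_step w B by move: ss; rewrite eqs => /cat_sorted2[_].
  have sD : path mate_step u D by move: sr; rewrite eqr => /cat_sorted2[_].
  have uB : uniq (mate_walk (w :: B)).
    by move: us; rewrite eqs mate_walk_cat cat_uniq => /and3P[].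
  have uD : uniq (mate_walk (u :: D)).
    by move: ur; rewrite eqr mate_walk_cat cat_uniq => /and3P[].
  have walk_s : mate_walk s = rev (mate_walk D) ++ mate_walk (m u :: E) ++ mate_walk B.
    by rewrite eq_s !mate_walk_cat mate_walk_rev.
  have := us; rewrite walk_s cat_uniq => /and3P[_ disjD].
  rewrite cat_uniq => /and3P[uE /hasPn disjB _].
  have lastW : last (m u) (m (m u) :: mate_walk E) = m w.
    by rewrite /= last_mate_walk lastE.
  have disj v : v \in mate_walk (m u :: E) ->
      (v \notin mate_walk D) && (v \notin mate_walk B).
    move=> vE; apply/andP; split; last by apply: contraL vE => /disjB.
    by apply: contraNN disjD => vD; apply/hasP; exists v; rewrite ?mem_cat ?vE ?mem_rev.
  have uwE : m u \in mate_walk (m u :: E) by rewrite mem_head.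
  have mwE : m w \in mate_walk (m u :: E) by rewrite -lastW mem_last.
  exists (m u :: mate_walk D), (m w :: mate_walk B), (m u), (m (m u) :: mate_walk E).
  split.
    split; rewrite ?lastW.
    - exact: mate_walk_blossom.
    - exact: mate_walk_blossom.
    - exact: mate_walk_mm_path.
    - move=> v vE vu vw; rewrite !inE (negPf vu) (negPf vw) /=.
      exact: disj.
    - left=> v; apply/negP; rewrite !inE => /andP[/predU1P[->|vD] /predU1P[eqv|vB]].
      + by move: uE; rewrite [mate_walk _]/= cons_uniq {1}eqv -lastE -last_mate_walk mem_last.
      + by have /andP[_ /negP[]] := disj _ uwE.
      + by have /andP[/negP[]] := disj _ mwE; rewrite -eqv.
      + move/negP: disjD; apply; apply/hasP; exists v; rewrite ?mem_rev //.
        by rewrite mem_cat vB orbT.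
  move=> v; rewrite !mem_cat mem_rev !(in_cons _ _ v) => /or3P[->|->|->];
  by rewrite !orbT.
(* Now [w] strictly precedes [m u]. The cycle runs along [s] up to [w], then along [rcons C u],
   which reads backwards the part of [s] from [m u] on; whatever lies strictly between is
   skipped. *)
have us' : uniq (mate_walk (rcons A w ++ rcons C u)).
  have eqC : rcons C u = rev (map m (m u :: rev (map m C))).
    by rewrite /= rev_cons rev_mate_rev mK.
  move: us; rewrite eqs' eqF -[A ++ _]cat_rcons -catA !mate_walk_cat uniq_catCA cat_uniq.
  case/and3P=> _ _; rewrite eqC mate_walk_rev.
  by apply: etrans; apply: perm_uniq; rewrite perm_cat2l perm_rev.
have : ~~ cycle mate_step (rcons A w ++ rcons C u).
  by apply: no_mate_step_cycle => //; case: (A).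
have /hasPn disj : ~~ has (mem (rcons A w)) (rcons C u).
  by have := uniq_of_mate_walk us'; rewrite cat_uniq => /and3P[].
have sA : sorted mate_step (rcons A w).
  by move: ss; rewrite eqs -cat_rcons => /cat_sorted2[].
have sC : sorted mate_step (rcons C u).
  by move: sr; rewrite eqr -cat_rcons => /cat_sorted2[].
case/negP.
(* Irreflexivity makes [B] and [D] nonempty. Their last letters [b] and [d] have as mates the first
   letters of the two arcs, so [ewB] and [euD] link the arcs into a cycle. *)
case/lastP: B => [|B b] in eqs ewB *; first by rewrite e_irr in ewB.
case/lastP: D => [|D d] in eqr euD eqs' eqF *; first by rewrite e_irr in euD.
rewrite !last_rcons in ewB euD.
have headA : head w (rcons A w) = m d.
  transitivity (head w s); first by rewrite eqs -cat_rcons; case: (A).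
  by rewrite eqs' map_rcons rev_rcons.
have headC : head u (rcons C u) = m b.
  transitivity (head u (rev (map m s))); first by rewrite eqr -cat_rcons; case: (C).
  by rewrite eqs -rcons_cons -rcons_cat map_rcons rev_rcons.
have lastA : last w (rcons A w) = w by rewrite last_rcons.
have lastC : last u (rcons C u) = u by rewrite last_rcons.
have cons_rcons a (X : seq T) : {h & {P | rcons X a = h :: P}}.
  by case: X => [|h X]; [exists a, [::] | exists h, (rcons X a)].
have [[h [P eqP]] [k [Q eqQ]]] := (cons_rcons w A, cons_rcons u C).
rewrite eqP eqQ /= in headA headC lastA lastC sA sC disj *.
rewrite rcons_cat rcons_cons cat_path /= rcons_path sA lastA sC lastC.
rewrite /mate_step headA headC ewB euD /= -headA -headC.
apply/andP; split.
  by apply: contraNneq (disj _ (mem_head k Q)) => ->; rewrite -lastA mem_last.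
have : u \in k :: Q by rewrite -lastC mem_last.
by move/disj; apply: contraNneq => <-; apply: mem_head.
Qed.

Lemma mate_in_Tposy : (forall v, ~~ leaf e v) -> forall v, in_Tposy e M v.
Proof.
move=> nl v.
pose P s := [&& sorted mate_step s, uniq (mate_walk s) & v \in mate_walk s].
have P0 : P [:: v] by rewrite /P /= !inE !eqxx eq_sym mate_neq.
have Puniq s : P s -> uniq s by case/and3P=> _ /uniq_of_mate_walk.
have [s Ps smax] := exists_longest Puniq P0.
(* Stated for every walk of the greatest length, so that it applies to [s] and to its reversal. *)
have ends s' : P s' -> size s' = size s ->
    exists A w B, s' = A ++ w :: B /\ e (m w) (m (last w B)).
  case/and3P; case: s' => // x s' p us vs eqsz.
  apply: mate_walk_end => // y step_y; apply: contraT => y_s.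
  have /smax : P (rcons (x :: s') y).
    apply/and3P; split; first by rewrite /= rcons_path [path _ _ _]p.
      by rewrite uniq_mate_walk_rcons us y_s.
    by rewrite -cats1 mate_walk_cat mem_cat vs.
  by rewrite size_rcons eqsz ltnn.
have [A [w [B [eqs ewB]]]] := ends s Ps erefl.
have [ss us vs] := and3P Ps.
have [||C [u [D [eqr euD]]]] := ends (rev (map m s)).
- by rewrite /P sorted_mate_step_rev mate_walk_rev rev_uniq mem_rev; apply/and3P.
- by rewrite size_rev size_map.
have [c1 [c2 [x [p [Tp cover]]]]] := mate_walk_Tposy ss us eqs ewB eqr euD.
by exists c1, c2, x, p; split=> //; apply: cover.
Qed.

End Mate.

(** * Mates of a perfect matching, switching, and uniqueness *)

(** Saturation provides a partner for each vertex and disjointness makes it unique, so the choice of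
    partners is an involution. *)
Lemma perfect_mate M : perfect_matching e M ->
  exists m, [/\ involutive m, forall x, e x (m x) & M = mate_matching m].
Proof.
case/andP=> /andP[/subsetP sM /trivIsetP trivM] /forallP sat.
have memM E x : E \in M -> x \in E -> exists2 y, e x y & E = [set x; y].
  move=> /sM; rewrite inE => /existsP[a /existsP[b /andP[eab /eqP->]]].
  rewrite !inE => /orP[]/eqP->; first by exists b.
  by exists a; rewrite 1?e_sym // setUC.
have exm x : exists y, [set x; y] \in M.
  have /bigcupP[E EM xE] := sat x.
  by have [y _ eqE] := memM E x EM xE; exists y; rewrite -eqE.
have [m mP] := fin_all_exists exm.
have mE E x : E \in M -> x \in E -> E = [set x; m x].
  move=> EM xE; apply: contraTeq isT => /(trivM _ _ EM (mP x)).
  by move/pred0P/(_ x); rewrite /= xE set21.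
have em x : e x (m x) by rewrite -mem_edges sM.
exists m; split=> //.
- move=> x; have := mE _ (m x) (mP x) (set22 _ _).
  move/setP/(_ x); rewrite set21 !inE => /esym/orP[]/eqP // xm.
  by have := em x; rewrite -xm e_irr.
- apply/setP => E; apply/idP/imsetP => [EM|[x _ ->]]; last exact: mP.
  move: (sM _ EM); rewrite inE => /existsP[a /existsP[b /andP[_ /eqP eqE]]].
  by exists a => //; apply: mE EM _; rewrite eqE set21.
Qed.

(* Switching along an alternating cycle gives a second perfect matching. *)
Lemma unique_no_alternating_cycle M c :
    perfect_matching e M -> (forall M', perfect_matching e M' -> M' = M) ->
  ~~ alternating_cycle e M c.
Proof.
case/perfect_mate=> m [mK em ->] uniqM.
apply/negP=> /andP[/and3P[szc ec uc]].
rewrite cycle_edges_next // cycle_map => altc.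
have alt x : x \in c -> (next c x == m x) (+) (next c (next c x) == m (next c x)).
  by move/(next_cycle altc); rewrite /= /alternate !mem_mate_matching.
(* Exactly one of the two cycle edges at [x] is in the matching. *)
have altp x : x \in c -> (prev c x != m x) = (next c x == m x).
  move=> xc; have := alt (prev c x); rewrite mem_prev next_prev // => /(_ xc).
  by rewrite [x == _]eq_sym (can2_eq mK mK); case: (_ == _); case: (_ == _).
have mc x : x \in c -> m x \in c.
  move=> xc; have := altp x xc; case: (next c x =P m x) => [<-|_].
    by rewrite mem_next.
  by move/eqP <-; rewrite mem_prev.
(* On the cycle, the new mate is the neighbour along the cycle edge outside the matching; off the
   cycle, mates are kept. *)
pose m' x := if x \in c then if next c x == m x then prev c x else next c x else m x.
have m'K : involutive m'.
  move=> x; rewrite {2}/m'; case: ifPn => [xc|xc]; last first.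
    rewrite /m' ifN ?mK //; apply: contra xc => /mc; by rewrite mK.
  case: ifPn => nx.
    rewrite /m' mem_prev xc next_prev // ifN //.
    by rewrite eq_sym (can2_eq mK mK) altp.
  rewrite /m' mem_next xc ifT ?prev_next //.
  by have := alt x xc; rewrite (negPf nx).
have em' x : e x (m' x).
  rewrite /m'; case: ifP => [xc|_]; last exact: em.
  case: ifP => _; last exact: next_cycle.
  by rewrite e_sym; apply: prev_cycle.
have eqM := uniqM _ (mate_perfect m'K em').
have m'm x : m' x = m x.
  by apply/eqP; rewrite -(mem_mate_matching mK em) -(uniqM _ (mate_perfect m'K em')); apply: imset_f.
have [x xc] : exists x, x \in c by case: (c) szc => // x s _; exists x; apply: mem_head.
have := m'm x; have := altp x xc; rewrite /m' xc.
by case: ifPn => [_ /eqP//|/eqP].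
Qed.

Lemma no_alternating_cycle_unique M M' :
    perfect_matching e M -> (forall c, ~~ alternating_cycle e M c) ->
  perfect_matching e M' -> M' = M.
Proof.
case/perfect_mate=> m [mK em ->] no_cycle /perfect_mate[m' [m'K em' ->]].
by apply: eq_imset => x; rewrite (mate_unique mK em no_cycle m'K em').
Qed.

Lemma no_alternating_cycle_sterboul_deming M :
    perfect_matching e M -> (forall c, ~~ alternating_cycle e M c) ->
  (forall v, ~~ leaf e v) -> sterboul_deming e.
Proof.
move=> pM; have maxM := perfect_maximum pM.
case/perfect_mate: pM maxM => m [mK em ->] maxM no_cycle nl.
apply/setP => v; rewrite in_setC in_set0; apply/negbTE; rewrite negbK inE.
by apply/asboolP; exists (mate_matching m) => //; right; apply: mate_in_Tposy.
Qed.

End Graph.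

Theorem theorem3p2 (T : finType) (e : rel T)
    (e_sym : symmetric e) (e_irr : irreflexive e)
    (e_perfect : exists M : {set {set T}}, perfect_matching e M) :
  [<-> sterboul_deming e /\
         (exists! M : {set {set T}}, perfect_matching e M);
       (forall v : T, ~~ leaf e v) /\
         (exists2 M : {set {set T}}, perfect_matching e M &
            forall c : seq T, ~~ alternating_cycle e M c);
       (forall v : T, ~~ leaf e v) /\
         (forall M : {set {set T}}, perfect_matching e M ->
            forall c : seq T, ~~ alternating_cycle e M c)].
Proof.
tfae.
- case=> sd [M [pM uniqM]]; split; first exact: sterboul_deming_no_leaf sd.
  exists M => // c; apply: unique_no_alternating_cycle => // M' pM'.
  by rewrite (uniqM M').
- case=> nl [M pM no_cycle]; split=> // M' pM'.
  by rewrite (no_alternating_cycle_unique e_sym e_irr pM no_cycle pM').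
- case=> nl no_cycle; have [M pM] := e_perfect.
  have no_cycleM := no_cycle M pM; split.
    exact: (no_alternating_cycle_sterboul_deming e_sym e_irr pM no_cycleM nl).
  exists M; split=> // M' pM'.
  by rewrite (no_alternating_cycle_unique e_sym e_irr pM no_cycleM pM').
Qed.
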